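(* Let $\mathcal{A}$ be an abelian category and let $\mathcal{X},\mathcal{Y},\omega,\nu$ be classes of objects in $\mathcal{A}$ such that: $\mathcal{X}$ is pointed and closed under extensions; $\mathcal{Y}$ is pointed and closed under extensions; $\omega$ is a relative cogenerator in $\mathcal{X}$ with $\mathrm{id}_{\mathcal{X}}(\omega)=0$; and $\nu$ is a relative generator in $\mathcal{Y}$ with $\mathrm{pd}_{\mathcal{Y}}(\nu)=0$. Then $[(\mathcal{X},\omega);(\nu,\mathcal{Y})]$ is a strong finite balanced system if, and only if, the following conditions are satisfied: (1) $\mathrm{Ext}^1_{\mathcal{A}}(\omega^\wedge,\nu)=\mathrm{Ext}^2_{\mathcal{A}}(\mathcal{X},\nu)=0$. (2) $\mathrm{Ext}^1_{\mathcal{A}}(\omega,\nu^\vee)=\mathrm{Ext}^2_{\mathcal{A}}(\omega,\mathcal{Y})=0$. (3) $\mathrm{pd}_{\mathcal{Y}}(M)<\infty$ for every $M\in\omega^\wedge$. (4) $\mathrm{id}_{\mathcal{X}}(N)<\infty$ for every $N\in\nu^\vee$. (5) $\mathrm{id}_{\omega}(\nu)=0$.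
   Context: $\mathcal{A}$ is an abelian category, not assumed to have enough projectives or injectives; $\mathrm{Ext}^n_{\mathcal{A}}$ denotes Yoneda Ext. Classes of objects are closed under isomorphisms. $\mathrm{Ext}^n_{\mathcal{A}}(\mathcal{C},\mathcal{D})=0$ means $\mathrm{Ext}^n_{\mathcal{A}}(C,D)=0$ for all $C\in\mathcal{C}$, $D\in\mathcal{D}$. A class is pointed if it contains $0$. Relative dimensions. $\mathrm{pd}_{\mathcal{C}}(M)$ is the infimum of the $n\in\mathbb{N}$ with $\mathrm{Ext}^{i}_{\mathcal{A}}(M,\mathcal{C})=0$ for all $i\ge n+1$ ($\infty$ if there is none); $\mathrm{id}_{\mathcal{C}}(M)$ is the infimum of the $n\in\mathbb{N}$ with $\mathrm{Ext}^i_{\mathcal{A}}(\mathcal{C},M)=0$ for all $i\ge n+1$. For a class $\mathcal{D}$, $\mathrm{pd}_{\mathcal{C}}(\mathcal{D})=\sup\{\mathrm{pd}_{\mathcal{C}}(D):D\in\mathcal{D}\}$ and similarly $\mathrm{id}_{\mathcal{C}}(\mathcal{D})$. $\omega$ is a relative cogenerator in $\mathcal{X}$ if $\omega\subseteq\mathcal{X}$ and for every $X\in\mathcal{X}$ there is a short exact sequence $0\to X\to W\to X'\to0$ with $W\in\omega$, $X'\in\mathcal{X}$. $\nu$ is a relative generator in $\mathcal{Y}$ if $\nu\subseteq\mathcal{Y}$ and for every $Y\in\mathcal{Y}$ there is a short exact sequence $0\to Y'\to V\to Y\to0$ with $V\in\nu$, $Y'\in\mathcal{Y}$. For a class $\mathcal{C}$,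 $\mathcal{C}^\wedge$ is the class of objects $M$ admitting an exact sequence $0\to C_n\to\cdots\to C_0\to M\to0$ with $n\in\mathbb{N}$ and all $C_k\in\mathcal{C}$; $\mathcal{C}^\vee$ is the class of objects $N$ admitting an exact sequence $0\to N\to C^0\to\cdots\to C^n\to0$ with $n\in\mathbb{N}$ and all $C^k\in\mathcal{C}$. Finite balanced system. $[(\mathcal{X},\omega);(\nu,\mathcal{Y})]$ is a finite balanced system if: (fbs1) $\mathcal{X}$ is pointed and closed under extensions; (fbs2) $\mathcal{Y}$ is pointed and closed under extensions; (fbs3) $\omega$ is a relative cogenerator in $\mathcal{X}$ with $\mathrm{id}_{\mathcal{X}}(\omega)=0$; (fbs4) $\nu$ is a relative generator in $\mathcal{Y}$ with $\mathrm{pd}_{\mathcal{Y}}(\nu)=0$; (fbs5) $\mathrm{Ext}^1_{\mathcal{A}}(\mathcal{X}^\wedge,\nu)=\mathrm{Ext}^1_{\mathcal{A}}(\omega^\wedge,\mathcal{Y})=0$; (fbs6) $\mathrm{Ext}^1_{\mathcal{A}}(\omega,\mathcal{Y}^\vee)=\mathrm{Ext}^1_{\mathcal{A}}(\mathcal{X},\nu^\vee)=0$. It is strong if in addition $\mathrm{pd}_{\mathcal{Y}}(\omega)=0$ and $\mathrm{id}_{\mathcal{X}}(\nu)=0$. *)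

(* Defs.v *)
From mathcomp Require Import all_boot all_algebra.
From mathcomp Require Import boolp classical_sets.
From Stdlib Require Import Relation_Operators.

Set Implicit Arguments.
Unset Strict Implicit.
Unset Printing Implicit Defensive.

Import GRing.Theory.

Local Open Scope ring_scope.

Declare Scope cat_scope.
Delimit Scope cat_scope with cat.

Record preaddCat := PreaddCat {
  Ob :> Type;
  Mor : Ob -> Ob -> zmodType;
  idmor : forall X : Ob, Mor X X;
  mcomp : forall X Y Z : Ob, Mor Y Z -> Mor X Y -> Mor X Z;
  mcomp1m : forall (X Y : Ob) (f : Mor X Y), mcomp (idmor Y) f = f;
  mcompm1 : forall (X Y : Ob) (f : Mor X Y), mcomp f (idmor X) = f;
  mcompA : forall (X Y Z T : Ob) (h : Mor Z T) (g : Mor Y Z) (f : Mor X Y),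
    mcomp h (mcomp g f) = mcomp (mcomp h g) f;
  mcompDl : forall (X Y Z : Ob) (g g' : Mor Y Z) (f : Mor X Y),
    mcomp (g + g') f = mcomp g f + mcomp g' f;
  mcompDr : forall (X Y Z : Ob) (g : Mor Y Z) (f f' : Mor X Y),
    mcomp g (f + f') = mcomp g f + mcomp g f'
}.

Arguments Mor {p} X Y.
Arguments idmor {p} X.
Arguments mcomp {p X Y Z} g f.

Notation "g \o f" := (mcomp g f) : cat_scope.
Local Open Scope cat_scope.

Section Preadditive.
Variable A : preaddCat.
Implicit Types X Y Z T K Q I : A.

Definition mono X Y (f : Mor X Y) : Prop :=
  forall T (u v : Mor T X), f \o u = f \o v -> u = v.

Definition epi X Y (f : Mor X Y) : Prop :=
  forall T (u v : Mor Y T), u \o f = v \o f -> u = v.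

Definition is_zero Z : Prop :=
  (forall X (f g : Mor X Z), f = g) /\ (forall X (f g : Mor Z X), f = g).

Definition isomorphic X Y : Prop :=
  exists (f : Mor X Y) (g : Mor Y X), g \o f = idmor X /\ f \o g = idmor Y.

Definition is_kernel K X Y (k : Mor K X) (f : Mor X Y) : Prop :=
  f \o k = 0 /\
  forall T (t : Mor T X), f \o t = 0 -> exists! u : Mor T K, k \o u = t.

Definition is_cokernel X Y Q (q : Mor Y Q) (f : Mor X Y) : Prop :=
  q \o f = 0 /\
  forall T (t : Mor Y T), t \o f = 0 -> exists! u : Mor Q T, u \o q = t.

Definition is_biproduct X Y P (i1 : Mor X P) (i2 : Mor Y P)
    (p1 : Mor P X) (p2 : Mor P Y) : Prop :=
  [/\ p1 \o i1 = idmor X, p2 \o i2 = idmor Y, p1 \o i2 = 0, p2 \o i1 = 0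
    & (i1 \o p1) + (i2 \o p2) = idmor P].

End Preadditive.

Record abelianCat := AbelianCat {
  abBase :> preaddCat;
  ab_zero : exists Z : abBase, is_zero Z;
  ab_biproduct : forall X Y : abBase,
    exists (P : abBase) (i1 : Mor X P) (i2 : Mor Y P)
           (p1 : Mor P X) (p2 : Mor P Y), is_biproduct i1 i2 p1 p2;
  ab_kernel : forall (X Y : abBase) (f : Mor X Y),
    exists (K : abBase) (k : Mor K X), is_kernel k f;
  ab_cokernel : forall (X Y : abBase) (f : Mor X Y),
    exists (Q : abBase) (q : Mor Y Q), is_cokernel q f;
  ab_normal : forall (X Y : abBase) (m : Mor X Y),
    mono m -> exists (Z : abBase) (f : Mor Y Z), is_kernel m f;
  ab_conormal : forall (X Y : abBase) (e : Mor X Y),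
    epi e -> exists (Z : abBase) (f : Mor Z X), is_cokernel e f
}.

Section Abelian.
Variable A : abelianCat.
Implicit Types (X Y Z : A) (C D : set A).

(* Exactness at Y: the image of f, given by its epi-mono factorization, is the
   kernel of g. *)
Definition exact X Y Z (f : Mor X Y) (g : Mor Y Z) : Prop :=
  exists (I : A) (e : Mor X I) (m : Mor I Y),
    [/\ f = m \o e, epi e & is_kernel m g].

Definition short_exact X Y Z (f : Mor X Y) (g : Mor Y Z) : Prop :=
  [/\ mono f, exact f g & epi g].

(* A composable string X -> E_1 -> ... -> E_n -> Y with n intermediate
   objects, hence n.+1 arrows. *)
Fixpoint chain (n : nat) (X Y : A) : Type :=
  match n with
  | 0 => Mor X Y
  | n'.+1 => {E : A & (Mor X E * chain n' E Y)%type}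
  end.

(* Exactness of X -f-> Y -> ... -> Z -> 0 at Y and everywhere to its right. *)
Fixpoint exact_after (n : nat) X Y Z (f : Mor X Y) : chain n Y Z -> Prop :=
  match n with
  | 0 => fun g => exact f g /\ epi g
  | n'.+1 => fun c => let: existT E (g, c') := c in
      exact f g /\ exact_after g c'
  end.

(* Exactness of 0 -> X -> E_1 -> ... -> E_n -> Y -> 0; for n = 0 this is
   0 -> X -> Y -> 0. *)
Definition exact_chain (n : nat) X Y : chain n X Y -> Prop :=
  match n with
  | 0 => fun f => mono f /\ epi f
  | n'.+1 => fun c => let: existT E (f, c') := c in
      mono f /\ exact_after f c'
  end.

Fixpoint chain_mid (n : nat) (C : set A) X Y : chain n X Y -> Prop :=
  match n with
  | 0 => fun _ => True
  | n'.+1 => fun c => let: existT E (_, c') := c in C E /\ chain_mid C c'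
  end.

Fixpoint chain_mor (n : nat) X Y X' Y' (b : Mor X X') (a : Mor Y Y') :
    chain n X Y -> chain n X' Y' -> Prop :=
  match n with
  | 0 => fun f f' => a \o f = f' \o b
  | n'.+1 => fun c c' =>
      let: existT E (f, d) := c in
      let: existT E' (f', d') := c' in
      exists h : Mor E E', h \o f = f' \o b /\ chain_mor h a d d'
  end.

(* n-extensions 0 -> Y -> E_n -> ... -> E_1 -> X -> 0 of X by Y. *)
Definition yext (n : nat) X Y : Type := {c : chain n Y X | exact_chain c}.

(* Yoneda equivalence is generated by the morphisms of n-extensions which are
   the identity on both ends; Ext^n(X, Y) is the quotient of yext n X Y. *)
Definition yext_equiv (n : nat) X Y : yext n X Y -> yext n X Y -> Prop :=
  clos_refl_sym_trans (yext n X Y)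
    (fun c d => chain_mor (idmor Y) (idmor X) (sval c) (sval d)).

(* Ext^n(X, Y) = 0: for n > 0 the set of Yoneda classes has exactly one
   element; Ext^0(X, Y) is Mor X Y. *)
Definition Ext_eq0 (n : nat) X Y : Prop :=
  match n with
  | 0 => forall f : Mor X Y, f = 0
  | n'.+1 => exists c0 : yext n'.+1 X Y, forall c, yext_equiv c c0
  end.

Definition Ext_class_eq0 (n : nat) C D : Prop :=
  forall X Y, C X -> D Y -> Ext_eq0 n X Y.

Definition iso_closed C : Prop := forall X Y, isomorphic X Y -> C X -> C Y.

Definition pointed_class C : Prop := exists Z, is_zero Z /\ C Z.

Definition ext_closed C : Prop :=
  forall X Y Z (f : Mor X Y) (g : Mor Y Z),
    short_exact f g -> C X -> C Z -> C Y.

Definition rel_cogenerator (w X : set A) : Prop :=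
  (w `<=` X)%classic /\
  forall M, X M -> exists (W M' : A) (f : Mor M W) (g : Mor W M'),
    [/\ short_exact f g, w W & X M'].

Definition rel_generator (v Y : set A) : Prop :=
  (v `<=` Y)%classic /\
  forall M, Y M -> exists (M' V : A) (f : Mor M' V) (g : Mor V M),
    [/\ short_exact f g, v V & Y M'].

Definition res_fin C : set A := fun M =>
  exists (n : nat) (Cn : A) (c : chain n Cn M),
    [/\ C Cn, chain_mid C c & exact_chain c].

Definition cores_fin C : set A := fun N =>
  exists (n : nat) (Cn : A) (c : chain n N Cn),
    [/\ C Cn, chain_mid C c & exact_chain c].

End Abelian.

Arguments res_fin {A} C.
Arguments cores_fin {A} C.

Notation "C ^wedge" := (res_fin C) (at level 2, format "C ^wedge") : cat_scope.
Notation "C ^vee" := (cores_fin C) (at level 2, format "C ^vee") : cat_scope.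

(* Homological dimensions live in nat extended by infinity, encoded as
   [option nat] with [None] for infinity. *)
Definition inf_nat (P : nat -> Prop) : option nat :=
  match pselect (exists n, `[< P n >]) with
  | left h => Some (ex_minn h)
  | right _ => None
  end.

Definition dim_le (d : option nat) (n : nat) : Prop :=
  if d is Some m then (m <= n)%N else False.

(* The supremum of a set of dimensions as its least upper bound (infinity when
   there is no finite bound, 0 for the empty set). *)
Definition sup_dim (S : set (option nat)) : option nat :=
  inf_nat (fun n => forall d, S d -> dim_le d n).

Section Dimensions.
Variable A : abelianCat.
Implicit Types (M : A) (C D : set A).

Definition pd C M : option nat :=
  inf_nat (fun n => forall i X, (n.+1 <= i)%N -> C X -> Ext_eq0 i M X).

Definition idim C M : option nat :=
  inf_nat (fun n => forall i X, (n.+1 <= i)%N -> C X -> Ext_eq0 i X M).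

Definition pd_class C D : option nat :=
  sup_dim (fun d => exists2 M, D M & d = pd C M).

Definition idim_class C D : option nat :=
  sup_dim (fun d => exists2 M, D M & d = idim C M).

Record fbs (X w v Y : set A) : Prop := Fbs {
  fbs1 : pointed_class X /\ ext_closed X;
  fbs2 : pointed_class Y /\ ext_closed Y;
  fbs3 : rel_cogenerator w X /\ idim_class X w = Some 0%N;
  fbs4 : rel_generator v Y /\ pd_class Y v = Some 0%N;
  fbs5 : Ext_class_eq0 1 X^wedge v /\ Ext_class_eq0 1 w^wedge Y;
  fbs6 : Ext_class_eq0 1 w Y^vee /\ Ext_class_eq0 1 X v^vee
}.

Definition strong_fbs (X w v Y : set A) : Prop :=
  [/\ fbs X w v Y, pd_class Y w = Some 0%N & idim_class X v = Some 0%N].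

End Dimensions.

(* Main.v *)
(* Without projectives or injectives, a class in Ext^n(X, Y), presented as
   spliced short exact sequences starting at Y, vanishes iff the splice maps to
   another one starting at Y whose last sequence admits a lift from X.  This
   criterion is invariant under morphisms of extensions in both directions,
   hence under Yoneda equivalence, and it yields by induction on n the two
   pieces of the long exact sequence in the first variable that are needed;
   those in the second variable follow by passing to the opposite category.

   For the harder implication, dimension shifting along the sequences
   0 -> Y' -> V -> N -> 0 given by nu embeds Ext^i(M, N) in Ext^(i+k)(M, N_k)
   for M in the resolution closure of omega, and this vanishes for large k as
   pd_Y(M) is finite.  An object M of the resolution closure of X embeds, with
   cokernel in X, in an object of the resolution closure of omega (Auslander and
   Buchweitz), so Ext^1(M, nu) = 0 follows from Ext^1(omega^wedge, nu) = 0 and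
   Ext^2(X, nu) = 0.  The remaining conditions are dual. *)

Require Import Defs.
From mathcomp Require Import all_boot.
From mathcomp Require Import boolp classical_sets.
From mathcomp Require Import ssralg.
From Stdlib Require Import Relation_Operators.

Set Implicit Arguments.
Unset Strict Implicit.
Unset Printing Implicit Defensive.

Import GRing.Theory.
Local Open Scope ring_scope.
Local Open Scope cat_scope.

(** * Morphism calculus and pushouts in a preadditive category *)

Section Preadditive.
Variable A : preaddCat.
Implicit Types X Y Z : A.

Lemma mcomp0m X Y Z (f : Mor X Y) : (0 : Mor Y Z) \o f = 0.
Proof. by apply: (addrI (0 \o f)); rewrite -mcompDl !addr0. Qed.

Lemma mcompm0 X Y Z (g : Mor Y Z) : g \o (0 : Mor X Y) = 0.
Proof. by apply: (addrI (g \o 0)); rewrite -mcompDr !addr0. Qed.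

Lemma mcompNl X Y Z (g : Mor Y Z) (f : Mor X Y) : (- g) \o f = - (g \o f).
Proof. by apply: (addrI (g \o f)); rewrite -mcompDl !subrr mcomp0m. Qed.

Lemma mcompNr X Y Z (g : Mor Y Z) (f : Mor X Y) : g \o (- f) = - (g \o f).
Proof. by apply: (addrI (g \o f)); rewrite -mcompDr !subrr mcompm0. Qed.

Lemma mcompBl X Y Z (g g' : Mor Y Z) (f : Mor X Y) :
  (g - g') \o f = (g \o f) - (g' \o f).
Proof. by rewrite mcompDl mcompNl. Qed.

Lemma mcompBr X Y Z (g : Mor Y Z) (f f' : Mor X Y) :
  g \o (f - f') = (g \o f) - (g \o f').
Proof. by rewrite mcompDr mcompNr. Qed.

Lemma monoP X Y (f : Mor X Y) :
  (forall T (u : Mor T X), f \o u = 0 -> u = 0) -> mono f.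
Proof.
move=> f0 T u v /eqP; rewrite -subr_eq0 -mcompBr => /eqP /f0 /eqP.
by rewrite subr_eq0 => /eqP.
Qed.

Lemma mono_eq0 X Y T (f : Mor X Y) (u : Mor T X) :
  mono f -> f \o u = 0 -> u = 0.
Proof. by move=> mf fu; apply: mf; rewrite fu mcompm0. Qed.

Lemma epi_eq0 X Y T (f : Mor X Y) (u : Mor Y T) :
  epi f -> u \o f = 0 -> u = 0.
Proof. by move=> ef uf; apply: ef; rewrite uf mcomp0m. Qed.

Lemma mono_comp X Y Z (f : Mor X Y) (g : Mor Y Z) :
  mono f -> mono g -> mono (g \o f).
Proof. by move=> mf mg T u v; rewrite -!mcompA => /mg /mf. Qed.

Lemma kernel_mono K X Y (k : Mor K X) (f : Mor X Y) : is_kernel k f -> mono k.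
Proof.
case=> fk kU T u v kuv.
have [|w [_ wU]] := kU T (k \o u); first by rewrite mcompA fk mcomp0m.
by rewrite -(wU u) // -(wU v).
Qed.

Lemma cokernel_epi X Y Q (q : Mor Y Q) (f : Mor X Y) : is_cokernel q f -> epi q.
Proof.
case=> qf qU T u v quv.
have [|w [_ wU]] := qU T (u \o q); first by rewrite -mcompA qf mcompm0.
by rewrite -(wU u) // -(wU v).
Qed.

Lemma epi_compr X Y Z (f : Mor X Y) (g : Mor Y Z) : epi (g \o f) -> epi g.
Proof. by move=> egf T u v uv; apply: egf; rewrite !mcompA uv. Qed.

Lemma mono_compr X Y Z (f : Mor X Y) (g : Mor Y Z) : mono (g \o f) -> mono f.
Proof. by move=> egf T u v uv; apply: egf; rewrite -!mcompA uv. Qed.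

Lemma epi_idmor X : epi (idmor X).
Proof. by move=> T u v; rewrite !mcompm1. Qed.

(** Uniqueness of the mediating map is recorded as joint epimorphy of [i] and [i'], so that it can
    compare any two maps out of [P]. *)
Record is_pushout X Y Y' P (f : Mor X Y) (f' : Mor X Y')
    (i : Mor Y P) (i' : Mor Y' P) : Prop := IsPushout {
  pushout_comm : i \o f = i' \o f';
  pushout_ump : forall T (u : Mor Y T) (u' : Mor Y' T), u \o f = u' \o f' ->
    exists2 w : Mor P T, w \o i = u & w \o i' = u';
  pushout_epi : forall T (u v : Mor P T),
    u \o i = v \o i -> u \o i' = v \o i' -> u = v
}.

Lemma pushout_sym X Y Y' P (f : Mor X Y) (f' : Mor X Y')
    (i : Mor Y P) (i' : Mor Y' P) :
  is_pushout f f' i i' -> is_pushout f' f i' i.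
Proof.
case=> c U e; split=> // [T u u' uu'|T u v uv uv']; last exact: e.
by have [w wi wi'] := U T u' u (esym uu'); exists w.
Qed.

End Preadditive.

(** * Kernels, exactness and pushouts in an abelian category *)

Section Abelian.
Variable A : abelianCat.
Implicit Types X Y Z : A.

(** By normality [f] is the kernel of some [c]; [c] is zero because [f] is epi, so the identity of
    [Y] factors through [f]. *)
Lemma mono_epi_iso X Y (f : Mor X Y) : mono f -> epi f ->
  exists g : Mor Y X, g \o f = idmor X /\ f \o g = idmor Y.
Proof.
move=> mf ef; have [Z [c [cf fU]]] := ab_normal mf.
have c0 := epi_eq0 ef cf.
have [|g [fg _]] := fU Y (idmor Y); first by rewrite c0 mcomp0m.
by exists g; split=> //; apply: mf; rewrite mcompA fg mcomp1m mcompm1.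
Qed.

Lemma mono_kernel X Y Q (f : Mor X Y) (q : Mor Y Q) :
  mono f -> is_cokernel q f -> is_kernel f q.
Proof.
move=> mf [qf qU]; have [Z [c [cf fU]]] := ab_normal mf; split=> // T t qt.
apply: fU; have [c' [<- _]] := qU _ c cf.
by rewrite -mcompA qt mcompm0.
Qed.

Lemma epi_cokernel X Y K (f : Mor X Y) (k : Mor K X) :
  epi f -> is_kernel k f -> is_cokernel f k.
Proof.
move=> ef [fk kU]; have [Z [c [fc fU]]] := ab_conormal ef; split=> // T t tk.
apply: fU; have [c' [<- _]] := kU _ c fc.
by rewrite mcompA tk mcomp0m.
Qed.

(** The epi part of the image factorization of a mono is also mono, hence invertible. *)
Lemma exact_kernel X Y Z (f : Mor X Y) (g : Mor Y Z) :
  mono f -> exact f g -> is_kernel f g.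
Proof.
move=> mf [I [e [m [fE ee km]]]].
have me : mono e by apply: (@mono_compr _ _ _ _ _ m); rewrite -fE.
have [e' [e'e ee']] := mono_epi_iso me ee.
case: km => gm mU; split; first by rewrite fE mcompA gm mcomp0m.
move=> T t gt; have [u [mu _]] := mU T t gt.
exists (e' \o u); split=> [|v fv]; last first.
  by apply: mf; rewrite fv fE -mcompA (mcompA e) ee' mcomp1m.
by rewrite fE -mcompA (mcompA e) ee' mcomp1m.
Qed.

Lemma short_exact_kernel X Y Z (f : Mor X Y) (g : Mor Y Z) :
  short_exact f g -> is_kernel f g.
Proof. by case=> mf ex _; apply: exact_kernel. Qed.

Lemma short_exact_cokernel X Y Z (f : Mor X Y) (g : Mor Y Z) :
  short_exact f g -> is_cokernel g f.
Proof. by move=> /[dup] /short_exact_kernel k [_ _ e]; apply: epi_cokernel. Qed.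

Lemma kernel_exact X Y Z (f : Mor X Y) (g : Mor Y Z) :
  is_kernel f g -> exact f g.
Proof.
by move=> k; exists X, (idmor X), f; rewrite mcompm1; split=> //; apply: epi_idmor.
Qed.

Lemma kernel_short_exact X Y Z (f : Mor X Y) (g : Mor Y Z) :
  is_kernel f g -> epi g -> short_exact f g.
Proof.
move=> k e; split=> //; [exact: kernel_mono k|exact: kernel_exact].
Qed.

Lemma cokernel_short_exact X Y Z (f : Mor X Y) (g : Mor Y Z) :
  mono f -> is_cokernel g f -> short_exact f g.
Proof.
by move=> m c; apply: kernel_short_exact; [apply: mono_kernel|exact: cokernel_epi c].
Qed.

(** An epi in front does not change the image. This lets the composite arrows of a chain be cut at
    their images. *)
Lemma exact_precomp X' X Y Z (e : Mor X' X) (f : Mor X Y) (g : Mor Y Z) :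
  epi e -> exact (f \o e) g <-> exact f g.
Proof.
move=> ee; split=> [] [I [d [m [fE ed km]]]].
  have gfe : (g \o f) \o e = 0.
    by rewrite -mcompA fE mcompA; case: km => -> _; rewrite mcomp0m.
  have [u [mu _]] := (proj2 km) X f (epi_eq0 ee gfe).
  exists I, u, m; split=> //; apply: (@epi_compr _ _ _ _ e).
  have -> : u \o e = d by apply: (kernel_mono km); rewrite mcompA mu.
  exact: ed.
exists I, (d \o e), m; split=> //; first by rewrite fE mcompA.
by move=> T u v; rewrite !mcompA => /ee /ed.
Qed.

(** The pushout is the cokernel of [d], the map (f, -f') into the biproduct. If [f] or [f'] is mono
    then so is [d], which is then the kernel of its cokernel; a map killed by [i'] or [i] therefore
    factors through [d], and comparing components shows that it is zero. *)
Lemma pushout_ex X Y Y' (f : Mor X Y) (f' : Mor X Y') :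
  exists P i i', [/\ @is_pushout A X Y Y' P f f' i i',
    mono f -> mono i' & mono f' -> mono i].
Proof.
have [B [i1 [i2 [p1 [p2 [e1 e2 e12 e21 es]]]]]] := ab_biproduct Y Y'.
pose d := (i1 \o f) - (i2 \o f').
have p1d : p1 \o d = f.
  by rewrite mcompBr !mcompA e1 e12 mcomp1m mcomp0m subr0.
have p2d : p2 \o d = - f'.
  by rewrite mcompBr !mcompA e2 e21 mcomp1m mcomp0m sub0r.
have [P [q /[dup] cq [qd qU]]] := ab_cokernel d.
exists P, (q \o i1), (q \o i2); split; first split.
- by apply/eqP; rewrite -!mcompA -subr_eq0 -mcompBr qd.
- move=> T u u' uu'.
  have [|w [wq _]] := qU T ((u \o p1) + (u' \o p2)).
    by rewrite mcompDl -!mcompA p1d p2d mcompNr uu' subrr.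
  exists w; rewrite mcompA wq mcompDl -!mcompA.
    by rewrite e1 e21 mcompm0 mcompm1 addr0.
  by rewrite e12 e2 mcompm0 mcompm1 add0r.
- move=> T u v ui ui'; apply: (cokernel_epi cq).
  by rewrite -(mcompm1 (u \o q)) -(mcompm1 (v \o q)) -es !mcompDr !mcompA -(mcompA u)
    -(mcompA u q) -(mcompA v) -(mcompA v q) ui ui'.
- move=> mf; apply: monoP => T u; rewrite -mcompA => qu.
  have md : mono d by apply: (@mono_compr _ _ _ _ _ p1); rewrite p1d.
  have [t [dt _]] := proj2 (mono_kernel md cq) T _ qu.
  have t0 : t = 0.
    by apply: (mono_eq0 mf); rewrite -p1d -mcompA dt mcompA e12 mcomp0m.
  by rewrite -(mcomp1m u) -e2 -mcompA -dt t0 !mcompm0.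
move=> mf; apply: monoP => T u; rewrite -mcompA => qu.
have md : mono d.
  apply: (@mono_compr _ _ _ _ _ p2); rewrite p2d.
  apply: monoP => S v; rewrite mcompNl => /eqP; rewrite oppr_eq0 => /eqP.
  exact: mono_eq0.
have [t [dt _]] := proj2 (mono_kernel md cq) T _ qu.
have t0 : t = 0.
  apply: (mono_eq0 mf); apply/eqP; rewrite -oppr_eq0 -mcompNl -p2d -mcompA dt.
  by rewrite mcompA e21 mcomp0m.
by rewrite -(mcomp1m u) -e1 -mcompA -dt t0 !mcompm0.
Qed.

Lemma pushout_short_exact X Y Y' P K (f : Mor X Y) (f' : Mor X Y')
    (i : Mor Y P) (i' : Mor Y' P) (p : Mor Y K) :
  is_pushout f f' i i' -> mono i' -> short_exact f p ->
  exists2 p' : Mor P K, short_exact i' p' & p' \o i = p.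
Proof.
move=> [c U e] mi' /short_exact_cokernel [pf pU].
have [|p' p'i p'i'] := U K p 0; first by rewrite pf mcomp0m.
exists p' => //; apply: cokernel_short_exact => //; split=> // T t ti'.
have [|s [sp _]] := pU T (t \o i); first by rewrite -mcompA c mcompA ti' mcomp0m.
have sp' : s \o p' = t by apply: e; rewrite -mcompA ?p'i ?p'i' ?ti' ?mcompm0.
exists s; split=> // s' s'p'; apply: (@cokernel_epi _ _ _ _ p f) => //.
by rewrite sp -p'i mcompA s'p'.
Qed.

(** * Short exact sequences with given ends and their morphisms *)

Record ses Y K := Ses {
  mid : A;
  inj : Mor Y mid;
  prj : Mor mid K;
  sesP : short_exact inj prj
}.

Lemma inj_mono Y K (s : ses Y K) : mono (inj s).
Proof. by case: (sesP s). Qed.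

Lemma prj_epi Y K (s : ses Y K) : epi (prj s).
Proof. by case: (sesP s). Qed.

Lemma prj_inj Y K (s : ses Y K) : prj s \o inj s = 0.
Proof. by case: (short_exact_kernel (sesP s)). Qed.

Lemma inj_factor Y K (s : ses Y K) T (t : Mor T (mid s)) :
  prj s \o t = 0 -> exists u, inj s \o u = t.
Proof.
by case: (short_exact_kernel (sesP s)) => _ U /U [u [ut _]]; exists u.
Qed.

Lemma prj_factor Y K (s : ses Y K) T (t : Mor (mid s) T) :
  t \o inj s = 0 -> exists u, u \o prj s = t.
Proof.
by case: (short_exact_cokernel (sesP s)) => _ U /U [u [ut _]]; exists u.
Qed.

Lemma mono_ses Y E (f : Mor Y E) : mono f ->
  exists (K : A) (p : Mor E K), short_exact f p.
Proof.
move=> mf; have [K [p cp]] := ab_cokernel f.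
by exists K, p; apply: cokernel_short_exact.
Qed.

Lemma ses_pushout Y K N (s : ses Y K) (g : Mor Y N) :
  exists (s' : ses N K) (h : Mor (mid s) (mid s')),
    is_pushout (inj s) g h (inj s') /\ prj s' \o h = prj s.
Proof.
have [P [i [i' [po mi' _]]]] := pushout_ex (inj s) g.
have [p' ex p'i] := pushout_short_exact po (mi' (@inj_mono _ _ s)) (sesP s).
by exists (Ses ex), i.
Qed.

Definition smor Y K Y' K' (s : ses Y K) (s' : ses Y' K')
    (b : Mor Y Y') (a : Mor K K') : Prop :=
  exists h : Mor (mid s) (mid s'),
    h \o inj s = inj s' \o b /\ prj s' \o h = a \o prj s.

Lemma smor_id Y K (s : ses Y K) : smor s s (idmor Y) (idmor K).
Proof. by exists (idmor _); rewrite !mcomp1m !mcompm1. Qed.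

Lemma smor_comp Y K Y' K' Y'' K'' (s : ses Y K) (s' : ses Y' K')
    (s'' : ses Y'' K'') b a b' a' :
  smor s s' b a -> smor s' s'' b' a' -> smor s s'' (b' \o b) (a' \o a).
Proof.
move=> [h [hj ph]] [h' [hj' ph']]; exists (h' \o h).
by rewrite -mcompA hj !mcompA hj' ph' -!mcompA ph.
Qed.

Lemma smor_ext Y K Y' K' (s : ses Y K) (s' : ses Y' K') (b : Mor Y Y')
    (h : Mor (mid s) (mid s')) :
  h \o inj s = inj s' \o b -> exists2 a, smor s s' b a & a \o prj s = prj s' \o h.
Proof.
move=> hj; have [|a ap] := @prj_factor _ _ s _ (prj s' \o h).
  by rewrite -mcompA hj mcompA prj_inj mcomp0m.
by exists a => //; exists h.
Qed.

(** * Vanishing of classes *)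

(* A word stands for a class in Ext^n(X, Y): the pullback along the final map
   X -> K of a splice of n short exact sequences leading from Y to K. *)
Fixpoint word (n : nat) (Y X : A) : Type :=
  match n with
  | 0 => Mor X Y
  | n'.+1 => {K : A & (ses Y K * word n' K X)%type}
  end.

(* [kills w g q]: the class g_* w lies in the image of Ext^n(X, q); for n > 0
   the argument q is immaterial and the condition says that g_* w = 0. *)
Fixpoint kills (n : nat) X Y : word n Y X -> forall N I, Mor Y N -> Mor I N -> Prop :=
  match n with
  | 0 => fun x N I g q => exists y : Mor X I, q \o y = g \o x
  | n'.+1 => fun w N I g q => let: existT K (s, d) := w in
      exists Q (s' : ses N Q) (t : Mor K Q), smor s s' g t /\ kills d t (prj s')
  end.

(** Such a morphism witnesses that the pushforward of [w] along [b] and the pullback of [w'] along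
    [a] are the same class. *)
Fixpoint wmor (n : nat) X Y X' Y' (b : Mor Y Y') (a : Mor X X') :
    word n Y X -> word n Y' X' -> Prop :=
  match n with
  | 0 => fun x x' => b \o x = x' \o a
  | n'.+1 => fun w w' =>
      let: existT K (s, d) := w in
      let: existT K' (s', d') := w' in
      exists t : Mor K K', smor s s' b t /\ wmor t a d d'
  end.

(** Pushing the refinement [s1] out along [s] gives a map [h] of middle objects, which takes the
    place of [r] one sequence further on. *)
Lemma kills_comp n X Y (w : word n Y X) N I (g : Mor Y N) (q : Mor I N)
    N' I' (q' : Mor I' N') (r : Mor I I') (s : Mor N N') :
  q' \o r = s \o q -> kills w g q -> kills w (s \o g) q'.
Proof.
elim: n Y w N I g q N' I' q' r s => [|n IH] Y w N I g q N' I' q' r s qr /=.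
  by move=> [y qy]; exists (r \o y); rewrite mcompA qr -!mcompA qy.
case: w => K [s0 d] [Q [s1 [t [m kd]]]].
have [s2 [h [po ph]]] := ses_pushout s1 s.
exists Q, s2, t; split.
  rewrite -(mcomp1m t); apply: smor_comp m _; exists h.
  by rewrite ph (pushout_comm po) mcomp1m.
by rewrite -(mcomp1m t); apply: (IH _ _ _ _ _ _ _ _ _ h _ _ kd); rewrite ph mcomp1m.
Qed.

Lemma kills_wmor n X Y X' Y' (w : word n Y X) (w' : word n Y' X')
    (b : Mor Y Y') (a : Mor X X') N I (g : Mor Y' N) (q : Mor I N) :
  wmor b a w w' -> kills w' g q -> kills w (g \o b) q.
Proof.
elim: n Y Y' w w' b N I g q => [|n IH] Y Y' w w' b N I g q /=.
  by move=> bw [y qy]; exists (y \o a); rewrite mcompA qy -!mcompA bw.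
case: w w' => K [s d] [K' [s' d']] [t [m md]] [Q [s1 [t1 [m1 k1]]]].
by exists Q, s1, (t1 \o t); split; [apply: smor_comp m m1|apply: IH md k1].
Qed.

(* [t] and [t + prj s \o u] are induced by homotopic maps into [s]: the two
   pushforwards define the same class once [s] is enlarged. *)
Lemma kills_homotopy n X K (d : word n K X) N0 N (s : ses N0 N)
    (t : Mor K N) (u : Mor K (mid s)) :
  kills d t (prj s) ->
  exists N' (s' : ses N0 N') (r : Mor N N'), smor s s' (idmor N0) r /\
    kills d (r \o (t + (prj s \o u))) (prj s').
Proof.
case: n d => [|n] /= d.
  move=> [y qy]; exists N, s, (idmor N); split; first exact: smor_id.
  by exists (y + (u \o d)); rewrite mcomp1m mcompDr mcompDl qy mcompA.
case: d => L [sK d] [R [sN [t1 [[h [hj ph]] kd]]]].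
(* Enlarging [mid s] to [mid s1] lets [u] extend over [mid sK], as [u']. The summand of the final
   map built from [u'] vanishes under [prj sN'], so it changes only the left end of the morphism. *)
have [s1 [u' [po pu']]] := ses_pushout sK u.
have [N' [q' ex]] := mono_ses (mono_comp (@inj_mono _ _ s) (@inj_mono _ _ s1)).
pose s' := Ses ex.
have [|r mr rp] := @smor_ext _ _ _ _ s s' (idmor _) (inj s1).
  by rewrite mcompm1.
exists N', s', r; split=> //.
have [sN' [h' [po' ph']]] := ses_pushout sN r.
exists R, sN', t1; split; last first.
  by rewrite -(mcomp1m t1); apply: (kills_comp (r := h')) kd; rewrite ph' mcomp1m.
exists ((h' \o h) + (inj sN' \o q' \o u')); split.
  rewrite mcompDl -!mcompA hj (pushout_comm po) !mcompA (pushout_comm po').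
  by rewrite mcompDr !mcompA -(mcompA _ r (prj s)) rp -!mcompA.
by rewrite mcompDr !mcompA prj_inj !mcomp0m addr0 ph' ph.
Qed.

(* The refinement of w and the map w -> w' are amalgamated by pushouts; on w
   the resulting square commutes only up to homotopy. *)
Lemma kills_wmor_inv n X Y Y' (w : word n Y X) (w' : word n Y' X)
    (b : Mor Y Y') N I (g : Mor Y' N) (q : Mor I N) :
  wmor b (idmor X) w w' -> kills w (g \o b) q -> kills w' g q.
Proof.
elim: n Y Y' w w' b N I g q => [|n IH] Y Y' w w' b N I g q /=.
  by rewrite mcompm1 => <- [y qy]; exists y; rewrite mcompA.
case: w w' => K [s d] [K' [s' d']] [v [[f [fj pf]] md]].
move=> [Q [s1 [t [[h [hj ph]] kd]]]].
have [sP [hP [poP phP]]] := ses_pushout s' g.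
have [J [l [m [po mm _]]]] := pushout_ex (inj s1) (inj sP).
have {}mm := mm (@inj_mono _ _ s1).
have [R [qJ ex]] := mono_ses (mono_comp (@inj_mono _ _ sP) mm).
pose sJ := Ses ex.
have [|t' _ t'p] := @smor_ext _ _ _ _ s' sJ g (m \o hP).
  by rewrite -mcompA (pushout_comm poP) mcompA.
have [|r _ rp] := @smor_ext _ _ _ _ s1 sJ (idmor _) l.
  by rewrite (pushout_comm po) mcompm1.
(* The routes from [mid s] to [J] through [f] and through [h] agree on [Y]; their difference factors
   through [K], and this is the homotopy. *)
have [|u up] := @prj_factor _ _ s _ ((m \o hP \o f) - (l \o h)).
  rewrite mcompBl -!mcompA fj hj !mcompA (pushout_comm po) -(mcompA m).
  by rewrite (pushout_comm poP) !mcompA subrr.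
have tv : t' \o v = (r \o t) + (prj sJ \o u).
  apply: (@prj_epi _ _ s); rewrite mcompDl -!mcompA up -ph -pf !mcompA rp t'p.
  by rewrite mcompBr !mcompA addrC subrK.
have kd' : kills d (r \o t) (prj sJ) by apply: (kills_comp (r := l)) kd.
have [R' [sJ' [r' [m' kd'']]]] := @kills_homotopy _ _ _ _ _ _ sJ _ u kd'.
exists R', sJ', (r' \o t'); split.
  rewrite -(mcomp1m g); apply: smor_comp m'; exists (m \o hP); split=> //.
  by rewrite -mcompA (pushout_comm poP) mcompA.
by apply: IH md _; rewrite -mcompA tv.
Qed.

Fixpoint word_pull (n : nat) Y X' X (a : Mor X' X) : word n Y X -> word n Y X' :=
  match n with
  | 0 => fun x => x \o a
  | n'.+1 => fun w => let: existT K (s, d) := w in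
      existT _ K (s, word_pull a d)
  end.

(* [connects s k dk]: dk represents the image of k under the connecting map
   Ext^n(K, Y) -> Ext^(n+1)(M, Y) of s. *)
Fixpoint connects (n : nat) Y K M (s : ses K M) :
    word n Y K -> word n.+1 Y M -> Prop :=
  match n with
  | 0 => fun z dk => let: existT L (s', x) := dk in smor s s' z x
  | n'.+1 => fun k dk => let: existT L (s', k') := k in
      exists dk', dk = existT _ L (s', dk') /\ connects s k' dk'
  end.

Lemma connects_ex n Y K M (s : ses K M) (k : word n Y K) :
  exists dk, connects s k dk.
Proof.
elim: n Y k => [|n IH] Y k.
  have [s' [h [po ph]]] := ses_pushout s k.
  exists (existT _ M (s', idmor M)); exists h.
  by rewrite (pushout_comm po) ph mcomp1m.
case: k => L [s' k]; have [dk c] := IH L k.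
by exists (existT _ L (s', dk)); exists dk.
Qed.

(** Exactness at Ext^n(K, -): a class whose connecting image vanishes comes from the middle object.
    For n = 0, the two maps [h \o e] and [y \o prj s] into the refinement have the same projection,
    and their difference yields the extension over [mid s]. *)
Lemma connects_kills n Y K M (s : ses K M) (k : word n Y K) (dk : word n.+1 Y M)
    N I (g : Mor Y N) (q : Mor I N) :
  connects s k dk -> kills dk g q ->
  exists k' : word n N (mid s), wmor g (inj s) k k'.
Proof.
elim: n Y k dk N I g q => [|n IH] Y k dk N I g q.
  case: dk => L [s1 x] [e [ej pe]] [Q [s2 [t [[h [hj ph]] [y qy]]]]].
  have [|k' jk'] := @inj_factor _ _ s2 _ ((h \o e) - (y \o prj s)).
    by rewrite mcompBr !mcompA ph qy -!mcompA pe subrr.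
  exists k'; apply: (@inj_mono _ _ s2); rewrite !mcompA jk' mcompBl -!mcompA.
  by rewrite prj_inj mcompm0 subr0 ej !mcompA hj.
case: k => L [s1 k] [dk' [-> c]] [Q [s2 [t [m kd]]]].
have [k' mk'] := IH L k dk' Q (mid s2) t (prj s2) c kd.
by exists (existT _ Q (s2, k')); exists t.
Qed.

(** Exactness at Ext^(n+1)(M, -): a class that vanishes on the middle object is a connecting image.
    For n = 0, the lift over [mid s] restricts on [K] to a map into [N]. *)
Lemma kills_pull_connects n Y K M (s : ses K M) (w : word n.+1 Y M)
    N I (g : Mor Y N) (q : Mor I N) :
  kills (word_pull (prj s) w) g q ->
  exists (k : word n N K) (w' : word n.+1 N M),
    wmor g (idmor M) w w' /\ connects s k w'.
Proof.
elim: n Y w N I g q => [|n IH] Y [L [s1 w]] N I g q.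
  move=> [Q [s2 [t [m [y qy]]]]].
  have [|k jk] := @inj_factor _ _ s2 _ (y \o inj s).
    by rewrite mcompA qy -!mcompA prj_inj !mcompm0.
  exists k, (existT _ Q (s2, t \o w)); split.
    by exists t; rewrite /= mcompm1.
  by exists y; rewrite jk -mcompA.
move=> [Q [s2 [t [m kd]]]].
have [k [w' [mw c]]] := IH L w Q (mid s2) t (prj s2) kd.
exists (existT _ Q (s2, k)), (existT _ Q (s2, w')).
by split; [exists t|exists w'].
Qed.

(** The connecting map sends vanishing classes to vanishing classes. For n = 0 the class vanishes
    only modulo maps lifting along [prj s0], so [s0] has to be enlarged by the pushout of [s] along
    the lift. *)
Lemma kills_connects n Y K M (s : ses K M) (k : word n Y K) (dk : word n.+1 Y M)
    N0 N (s0 : ses N0 N) (g : Mor Y N) :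
  connects s k dk -> kills k g (prj s0) ->
  exists N' (s1 : ses N0 N') (r : Mor N N'), smor s0 s1 (idmor N0) r /\
    kills dk (r \o g) (prj s1).
Proof.
elim: n Y k dk N0 N s0 g => [|n IH] Y k dk N0 N s0 g.
  case: dk => L [sL x] [e [ej pe]] [y qy].
  have [sI [y' [po py']]] := ses_pushout s y.
  have [N' [q' ex]] := mono_ses (mono_comp (@inj_mono _ _ s0) (@inj_mono _ _ sI)).
  pose s1 := Ses ex.
  have [|r mr rp] := @smor_ext _ _ _ _ s0 s1 (idmor _) (inj sI).
    by rewrite mcompm1.
  exists N', s1, r; split=> //.
  have [s2 [h [po' ph]]] := ses_pushout sL (r \o g).
  exists L, s2, (idmor L); split.
    by exists h; rewrite (pushout_comm po') ph mcomp1m.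
  have [|z zp] := @prj_factor _ _ s _ ((h \o e) - (inj s2 \o q' \o y')).
    rewrite mcompBl -!mcompA (pushout_comm po) ej !mcompA (pushout_comm po').
    by rewrite -!mcompA -qy !mcompA -(mcompA _ r) rp -!mcompA subrr.
  exists z; apply: (@prj_epi _ _ s); rewrite -mcompA zp mcompBr !mcompA.
  by rewrite prj_inj !mcomp0m subr0 ph mcomp1m pe.
case: k => L [s1 k] [dk' [-> c]] [Q [s2 [t [m kd]]]].
have [N' [s3 [r [m' kd']]]] := IH L k dk' N Q s2 t c kd.
exists N, s0, (idmor N); split; first exact: smor_id.
exists N', s3, (r \o t); split=> //.
exact: smor_comp m m'.
Qed.

(* Indexing: [ext_vanish n] is about Ext^(n+1), splices of n+1 sequences. *)
Definition ext_vanish (n : nat) X Y : Prop :=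
  forall w : word n.+1 Y X, kills w (idmor Y) (idmor Y).

Lemma ext_vanish_sub n K M Y (s : ses K M) :
  ext_vanish n (mid s) Y -> ext_vanish n.+1 M Y -> ext_vanish n K Y.
Proof.
move=> vW vM w; have [dw c] := connects_ex s w.
have [w' m] := connects_kills c (vM dw).
by rewrite -(mcompm1 (idmor Y)); apply: kills_wmor m (vW w').
Qed.

Lemma ext_vanish_quo n K M Y (s : ses K M) :
  ext_vanish n K Y -> ext_vanish n.+1 (mid s) Y -> ext_vanish n.+1 M Y.
Proof.
move=> vK vW w.
have [k [w' [m c]]] := kills_pull_connects (vW (word_pull (prj s) w)).
rewrite -(mcompm1 (idmor Y)); apply: kills_wmor m _.
case: k w' c => L [s1 k] w' [dw [-> c]].
(* The first sequence is common to the class and its connecting image, so the tails are compared,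
   with [s2] as the sequence to enlarge. *)
have [Q [s2 [t [m kd]]]] := vK (existT _ L (s1, k)).
have [N' [s3 [r [m' kd']]]] := kills_connects c kd.
exists N', s3, (r \o t); split=> //.
by rewrite -(mcompm1 (idmor Y)); apply: smor_comp m m'.
Qed.

End Abelian.

(** * The opposite abelian category *)

Section Opposite.
Variable A : abelianCat.

Definition op_base : preaddCat :=
  @PreaddCat A (fun X Y => Mor Y X) idmor (fun _ _ _ g f => f \o g)
    (fun _ _ f => mcompm1 f) (fun _ _ f => mcomp1m f)
    (fun _ _ _ _ h g f => esym (mcompA f g h))
    (fun _ _ _ g g' f => mcompDr f g g') (fun _ _ _ g f f' => mcompDl f f' g).

Lemma op_zero : exists Z : op_base, is_zero Z.
Proof. by have [Z [z1 z2]] := ab_zero A; exists Z. Qed.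

Lemma op_biproduct (X Y : op_base) :
  exists (P : op_base) (i1 : Mor X P) (i2 : Mor Y P) (p1 : Mor P X) (p2 : Mor P Y),
    is_biproduct i1 i2 p1 p2.
Proof.
have [P [i1 [i2 [p1 [p2 [e1 e2 e12 e21 es]]]]]] := @ab_biproduct A X Y.
by exists P, p1, p2, i1, i2.
Qed.

Definition op : abelianCat :=
  @AbelianCat op_base op_zero op_biproduct
    (fun X Y f => @ab_cokernel A Y X f) (fun X Y f => @ab_kernel A Y X f)
    (fun X Y m => @ab_conormal A Y X m) (fun X Y e => @ab_normal A Y X e).

(** Exactness is defined by a kernel and is not literally self-dual; in a short exact sequence the
    cokernel description replaces it. *)
Lemma short_exact_op (X Y Z : A) (f : Mor X Y) (g : Mor Y Z) :
  short_exact f g <-> @short_exact op Z Y X g f.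
Proof.
split=> se.
  by apply: kernel_short_exact; [apply: short_exact_cokernel se|case: se].
apply: kernel_short_exact; last by case: se.
exact: (short_exact_cokernel se).
Qed.

Definition ses_op (Y K : A) (s : ses Y K) : @ses op K Y :=
  @Ses op K Y (mid s) (prj s) (inj s) (proj1 (short_exact_op _ _) (sesP s)).

(** [op (op A)] is not convertible to [A], so the way back is a construction of its own. *)
Definition ses_unop (Y K : A) (s : @ses op K Y) : ses Y K :=
  @Ses A Y K (mid s) (prj s) (inj s) (proj2 (short_exact_op _ _) (sesP s)).

Lemma ses_opK (Y K : A) (s : ses Y K) : ses_unop (ses_op s) = s.
Proof. by case: s => E i p ex; congr Ses; apply: Prop_irrelevance. Qed.

Lemma ses_unopK (Y K : A) (s : @ses op K Y) : ses_op (ses_unop s) = s.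
Proof. by case: s => E i p ex; congr Ses; apply: Prop_irrelevance. Qed.

Lemma smor_op (Y K Y' K' : A) (s : ses Y K) (s' : ses Y' K') b a :
  smor s s' b a -> smor (ses_op s') (ses_op s) a b.
Proof. by case=> h [hj ph]; exists h. Qed.

Lemma smor_unop (Y K Y' K' : A) (s : @ses op K Y) (s' : @ses op K' Y') b a :
  smor s' s a b -> smor (ses_unop s) (ses_unop s') b a.
Proof. by case=> h [hj ph]; exists h. Qed.

End Opposite.

Lemma ses_pullback (A : abelianCat) (Y K M : A) (s : ses Y K) (x : Mor M K) :
  exists s' : ses Y M, smor s' s (idmor Y) x.
Proof.
have [s' [h [po hp]]] := ses_pushout (ses_op s) x.
exists (ses_unop s'); exists h; split; last exact: (pushout_comm po).
by rewrite mcompm1; exact: hp.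
Qed.

(** * Splices of short exact sequences and Yoneda equivalence *)

Section Splices.
Variable A : abelianCat.
Implicit Types X Y Z : A.

(** Indexing: n+1 short exact sequences, representing a class in Ext^(n+1)(X, Y). *)
Fixpoint splice (n : nat) Y X : Type :=
  match n with
  | 0 => ses Y X
  | n'.+1 => {K : A & (ses Y K * splice n' K X)%type}
  end.

Fixpoint splmor (n : nat) Y X Y' X' (b : Mor Y Y') (a : Mor X X') :
    splice n Y X -> splice n Y' X' -> Prop :=
  match n with
  | 0 => fun s s' => smor s s' b a
  | n'.+1 => fun w w' =>
      let: existT K (s, d) := w in
      let: existT K' (s', d') := w' in
      exists t : Mor K K', smor s s' b t /\ splmor t a d d'
  end.

Definition spl_equiv n Y X : splice n Y X -> splice n Y X -> Prop :=
  clos_refl_sym_trans _ (splmor (idmor Y) (idmor X)).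

Fixpoint word_of (n : nat) Y X : splice n Y X -> word n.+1 Y X :=
  match n with
  | 0 => fun s => existT _ X (s, idmor X)
  | n'.+1 => fun w => let: existT K (s, d) := w in existT _ K (s, word_of d)
  end.

(** Splitting of the last sequence alone already makes the class zero. *)
Fixpoint splits (n : nat) Y X : splice n Y X -> Prop :=
  match n with
  | 0 => fun s => exists y : Mor X (mid s), prj s \o y = idmor X
  | n'.+1 => fun w => let: existT K (s, d) := w in splits d
  end.

Lemma wmor_word_of n Y X Y' X' (b : Mor Y Y') (a : Mor X X')
    (s : splice n Y X) (s' : splice n Y' X') :
  splmor b a s s' -> wmor b a (word_of s) (word_of s').
Proof.
elim: n Y Y' b s s' => [|n IH] Y Y' b /=.
  by move=> s s' m; exists a; split; rewrite //= mcompm1 mcomp1m.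
move=> [K [s d]] [K' [s' d']] [t [m md]].
by exists t; split=> //; apply: IH.
Qed.

(** The final map of the word is absorbed by pulling the last sequence back along it. *)
Lemma word_splice n Y X (w : word n.+1 Y X) :
  exists s : splice n Y X, wmor (idmor Y) (idmor X) (word_of s) w.
Proof.
elim: n Y w => [|n IH] Y [K [s d]].
  have [s' m] := ses_pullback s d.
  by exists s'; exists d; split; rewrite //= !mcompm1.
have [d' m] := IH K d.
by exists (existT _ K (s, d')); exists (idmor K); split; first exact: smor_id.
Qed.

Lemma splits_kills n Y X (s : splice n Y X) :
  splits s -> kills (word_of s) (idmor Y) (idmor Y).
Proof.
elim: n Y s => [|n IH] Y /=.
  move=> s [y py]; exists X, s, (idmor X); split; first exact: smor_id.
  by exists y; rewrite /= py mcomp1m.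
move=> [K [s d]] /IH kd; exists K, s, (idmor K); split; first exact: smor_id.
by case: n d kd {IH}.
Qed.

Lemma ses_split Y X : exists (s : ses Y X) (i : Mor X (mid s)) (r : Mor (mid s) Y),
  [/\ prj s \o i = idmor X, r \o inj s = idmor Y, r \o i = 0 &
    (inj s \o r) + (i \o prj s) = idmor (mid s)].
Proof.
have [P [i1 [i2 [p1 [p2 [e1 e2 e12 e21 es]]]]]] := ab_biproduct Y X.
have ex : short_exact i1 p2.
  apply: kernel_short_exact; last first.
    by apply: (@epi_compr _ _ _ _ i2); rewrite e2; apply: epi_idmor.
  split=> // T t pt; exists (p1 \o t); split.
    by rewrite -[RHS]mcomp1m -es mcompDl -!mcompA pt mcompm0 addr0.
  by move=> u <-; rewrite mcompA e1 mcomp1m.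
by exists (Ses ex), i2, p1.
Qed.

(** The witness is the biproduct sequence for n = 0, and otherwise begins with 0 -> Y = Y -> 0 -> 0.
    Since it maps to every splice ending in a split sequence, all of these are Yoneda equivalent. *)
Lemma trivial_splice n Y X : exists2 s0 : splice n Y X, splits s0 &
  forall Y' (s : splice n Y' X) (b : Mor Y Y'), splits s -> splmor b (idmor X) s0 s.
Proof.
elim: n Y => [|n IH] Y.
  have [s0 [i [r [pi rj ri es]]]] := ses_split Y X.
  exists s0; first by exists i.
  move=> Y' s b [y py]; exists ((inj s \o b \o r) + (y \o prj s0)); split.
    by rewrite mcompDl -!mcompA prj_inj rj mcompm0 addr0 mcompm1.
  by rewrite mcompDr !mcompA prj_inj py !mcomp0m add0r.
have [Z z0] := ab_zero A.
have ex : short_exact (idmor Y) (0 : Mor Y Z).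
  apply: kernel_short_exact => [|T u v _]; last exact: (proj2 z0).
  split=> [|T t _]; first exact: mcomp0m.
  by exists t; split=> [|u]; rewrite mcomp1m.
have [s0 sp0 U] := IH Z.
exists (existT _ Z (Ses ex, s0)) => // Y' [K [s d]] b sp.
exists 0; split; last exact: U.
exists (inj s \o b); rewrite mcompm1; split=> //.
by rewrite mcompA prj_inj !mcomp0m.
Qed.

Lemma kills_splits n Y X (s : splice n Y X) N I (g : Mor Y N) (q : Mor I N) :
  kills (word_of s) g q ->
  exists2 s' : splice n N X, splits s' & splmor g (idmor X) s s'.
Proof.
elim: n Y s N I g q => [|n IH] Y s N I g q /=.
  move=> [Q [s1 [t [[h [hj ph]] [y qy]]]]].
  (* Subtracting the lift turns [h] into an extension [r] of [g] over [mid s]; paired with [prj s]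
     it maps [s] to the biproduct sequence. *)
  have [|r jr] := @inj_factor _ _ _ s1 _ (h - (y \o prj s)).
    by rewrite mcompBr !mcompA ph qy mcompm1 subrr.
  have [s' [i [_ [pi _ _ _]]]] := ses_split N X.
  exists s'; first by exists i.
  exists ((inj s' \o r) + (i \o prj s)); split.
    rewrite mcompDl -!mcompA prj_inj mcompm0 addr0; congr (_ \o _).
    apply: (@inj_mono _ _ _ s1).
    by rewrite mcompA jr mcompBl -mcompA prj_inj mcompm0 subr0.
  by rewrite mcompDr !mcompA prj_inj pi mcomp0m add0r.
case: s => K [s d] [Q [s1 [t [m kd]]]].
have [d' sp md] := IH K d Q (mid s1) t (prj s1) kd.
by exists (existT _ Q (s1, d')) => //; exists t.
Qed.

Definition all_equiv n Y X : Prop :=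
  exists s0 : splice n Y X, forall s, spl_equiv s s0.

(** If all splices are equivalent, each is equivalent to the trivial one, and [kills] is invariant
    under morphisms in both directions. Conversely, a vanishing class maps to a splice that splits,
    which the trivial one also maps to. *)
Lemma all_equivP n Y X : all_equiv n Y X <-> ext_vanish n X Y.
Proof.
have [t0 sp0 U] := trivial_splice n Y X; split; last first.
  move=> v; exists t0 => s; have [s' sp m] := kills_splits (v (word_of s)).
  by apply: rst_trans (rst_step _ _ _ _ m) _; apply/rst_sym/rst_step/U.
case=> s0 eq0 w; have [s m] := word_splice w.
apply: (kills_wmor_inv m); rewrite mcompm1.
have {m} eqt : spl_equiv s t0.
  by apply: rst_trans (eq0 s) _; apply/rst_sym/eq0.
suff [_] : kills (word_of s) (idmor Y) (idmor Y) <->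
           kills (word_of t0) (idmor Y) (idmor Y).
  by apply; apply: splits_kills.
elim: eqt => {s t0 sp0 U w} [s t m|s|s t _ IH|s t u _ IH1 _ IH2].
- have {}m := wmor_word_of m; split=> k.
    by apply: (kills_wmor_inv m); rewrite mcompm1.
  by rewrite -(mcompm1 (idmor Y)); apply: kills_wmor m k.
- by [].
- exact: iff_sym IH.
- exact: iff_trans IH1 IH2.
Qed.

End Splices.

(** * Yoneda extensions as splices *)

Section Chains.
Variable A : abelianCat.
Implicit Types X Y Z : A.

Definition precomp (n : nat) X X' Y (p : Mor X' X) (c : chain n.+1 X Y) :
    chain n.+1 X' Y :=
  let: existT E (f, d) := c in existT _ E (f \o p, d).

Fixpoint chain_of (n : nat) Y X : splice n Y X -> chain n.+1 Y X :=
  match n with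
  | 0 => fun s => existT _ (mid s) (inj s, prj s)
  | n'.+1 => fun w => let: existT K (s, d) := w in
      existT _ (mid s) (inj s, precomp (prj s) (chain_of d))
  end.

Lemma exact_after_precomp n X X' Y Z (e : Mor X' X) (f : Mor X Y)
    (c : chain n Y Z) :
  epi e -> exact_after (f \o e) c <-> exact_after f c.
Proof.
move=> ee; case: n c => [|n] c /=.
  by rewrite exact_precomp.
by case: c => E [g c]; rewrite exact_precomp.
Qed.

Lemma chain_of_exact n Y X (s : splice n Y X) : exact_chain (chain_of s).
Proof.
elim: n Y s => [|n IH] Y /=.
  by move=> s; case: (sesP s).
case=> K [s d] /=; move: (IH K d).
case: (chain_of d) => E [f c] /= [mf ec].
split; first exact: inj_mono.
split; last by apply/exact_after_precomp => //; apply: prj_epi.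
apply: kernel_exact; have [pj U] := short_exact_kernel (sesP s).
split=> [|T t]; first by rewrite -mcompA pj mcompm0.
by rewrite -mcompA => /(mono_eq0 mf); apply: U.
Qed.

(** The second arrow is factored through its image, which cuts off one short exact sequence and
    leaves a shorter exact chain starting at the image. *)
Lemma exact_chain_of n Y X (c : chain n.+1 Y X) :
  exact_chain c -> exists s : splice n Y X, chain_of s = c.
Proof.
elim: n Y c => [|n IH] Y [E [f c]] [mf ec] /=.
  case: ec => ec epc; have ex : short_exact f c by [].
  by exists (Ses ex).
case: c ec => E' [g c] [fg ec].
have [I [e [m [gE ee mm c_ex]]]] : exists I (e : Mor E I) (m : Mor I E'),
    [/\ g = m \o e, epi e, mono m & exact_after m c].
  have [Z [h [I [e [m [gE ee km]]]]]] : exists Z (h : Mor E' Z), exact g h.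
    case: n c ec {IH} => [|n] c; first by case=> ec _; exists X, c.
    by case: c => E'' [h c] [gh _]; exists E'', h.
  exists I, e, m; split=> //; first exact: kernel_mono km.
  by apply/(exact_after_precomp m c ee); rewrite -gE.
have ex : short_exact f e.
  apply: kernel_short_exact => //; have [gf U] := exact_kernel mf fg; split.
    by apply: (mono_eq0 mm); rewrite mcompA -gE.
  by move=> T t et; apply: U; rewrite gE -mcompA et mcompm0.
have [|s sE] := IH I (existT _ E' (m, c)); first by [].
by exists (existT _ I (Ses ex, s)); rewrite sE /= gE.
Qed.

Lemma chain_mor_of n Y X Y' X' (b : Mor Y Y') (a : Mor X X')
    (s : splice n Y X) (s' : splice n Y' X') :
  chain_mor b a (chain_of s) (chain_of s') <-> splmor b a s s'.
Proof.
elim: n Y Y' b s s' => [|n IH] Y Y' b /=.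
  by move=> s s'; split=> [] [h [hj ph]]; exists h.
move=> [K [s d]] [K' [s' d']].
split=> [[h [hj hc]]|[t [[h [hj ph]] /IH]]]; last first.
  case: (chain_of d) => E [f c]; case: (chain_of d') => E' [f' c'].
  move=> [h' [h'f cc']]; exists h; split=> //; exists h'; split=> //.
  by rewrite mcompA h'f -!mcompA ph.
have [t m tp] := smor_ext hj.
exists t; split=> //; apply/IH; move: hc (chain_of_exact d) (chain_of_exact d').
case: (chain_of d) => E [f c]; case: (chain_of d') => E' [f' c'].
move=> [h' [h'f cc']] [mf _] [mf' _]; exists h'; split=> //.
by apply: (@prj_epi _ _ _ s); rewrite -mcompA h'f -!mcompA tp.
Qed.

Lemma Ext_eq0P n X Y : Ext_eq0 n.+1 X Y <-> all_equiv n Y X.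
Proof.
pose ext (s : splice n Y X) : yext n.+1 X Y := exist _ _ (chain_of_exact s).
have extK (c : yext n.+1 X Y) s : chain_of s = sval c -> ext s = c.
  by case: c => c ec /= sc; apply: eq_exist.
split=> [[c0 eq0]|[s0 eq0]].
  have [s0 sc0] := exact_chain_of (svalP c0); exists s0 => s.
  suff eqv (c d : yext n.+1 X Y) : yext_equiv c d -> forall s t, chain_of s = sval c ->
      chain_of t = sval d -> spl_equiv s t.
    exact: (eqv _ _ (eq0 (ext s)) _ _ erefl sc0).
  elim=> {c d s s0 sc0} [c d m|c|c d _ IH|c d e _ IH1 _ IH2] s t sc td.
  - by apply: rst_step; apply/chain_mor_of; rewrite sc td.
  (* Splices with the same chain may differ in the chosen images; the identity of the chain is a
     morphism between them. *)
  - apply: rst_step; apply/chain_mor_of; rewrite sc -td; apply/chain_mor_of.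
    elim: (n) (Y) (t) => [|k IH] Z /=; first by move=> u; apply: smor_id.
    by move=> [K [u u']]; exists (idmor K); split; first exact: smor_id.
  - by apply/rst_sym/IH.
  - have [u ud] := exact_chain_of (svalP d).
    exact: rst_trans (IH1 _ _ sc ud) (IH2 _ _ ud td).
exists (ext s0) => c; have [s sc] := exact_chain_of (svalP c).
rewrite -(extK c s sc); elim: (eq0 s) => {s0 eq0 c s sc}
  [s t m|s|s t _ IH|s t u _ IH1 _ IH2].
- by apply: rst_step; apply/chain_mor_of.
- exact: rst_refl.
- exact: rst_sym.
- exact: rst_trans IH1 IH2.
Qed.

End Chains.

Lemma Ext_vanish (A : abelianCat) n (X Y : A) : Ext_eq0 n.+1 X Y <-> ext_vanish n X Y.
Proof. by rewrite Ext_eq0P all_equivP. Qed.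

(** * Duality *)

Section Append.
Variable A : abelianCat.

(** Splices grow at the left end; reversing them for the opposite category requires adding at the
    right end. *)
Fixpoint rcons_spl (n : nat) (Y K X : A) :
    splice n Y K -> ses K X -> splice n.+1 Y X :=
  match n with
  | 0 => fun s t => existT _ K (s, t)
  | n'.+1 => fun w t => let: existT L (s, d) := w in
      existT _ L (s, rcons_spl d t)
  end.

Lemma splmor_rcons n (Y K X Y' K' X' : A) (b : Mor Y Y') (a : Mor K K')
    (a' : Mor X X') (d : splice n Y K) (d' : splice n Y' K') s s' :
  splmor b a d d' -> smor s s' a a' ->
  splmor b a' (rcons_spl d s) (rcons_spl d' s').
Proof.
move=> + m; elim: n Y Y' b d d' => [|n IH] Y Y' b /=.
  by move=> d d' md; exists a.
by move=> [L [s1 d]] [L' [s1' d']] [t [mt md]]; exists t; split; last exact: IH.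
Qed.

End Append.

Section Opposite_splices.
Variable A : abelianCat.

Fixpoint spl_op (n : nat) (Y X : A) : splice n Y X -> @splice (op A) n X Y :=
  match n with
  | 0 => fun s => ses_op s
  | n'.+1 => fun w => let: existT K (s, d) := w in
      @rcons_spl (op A) _ _ _ _ (spl_op d) (ses_op s)
  end.

Fixpoint spl_unop (n : nat) (Y X : A) : @splice (op A) n X Y -> splice n Y X :=
  match n return @splice (op A) n X Y -> splice n Y X with
  | 0 => fun s => ses_unop s
  | n'.+1 => fun w => let: existT K (s, d) := w in
      rcons_spl (@spl_unop n' Y K d) (ses_unop s)
  end.

Lemma spl_op_rcons n (Y K X : A) (d : splice n Y K) (s : ses K X) :
  spl_op (rcons_spl d s) = existT _ K (ses_op s, spl_op d) :> @splice (op A) n.+1 X Y.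
Proof.
elim: n Y d => [|n IH] Y // [L [s1 d]].
exact: (congr1 (fun c => @rcons_spl (op A) _ _ _ _ c (ses_op s1)) (IH L d)).
Qed.

Lemma spl_unop_rcons n (Y K X : A) (d : @splice (op A) n X K) (s : @ses (op A) K Y) :
  spl_unop (@rcons_spl (op A) n X K Y d s) = existT _ K (ses_unop s, spl_unop d).
Proof.
elim: n X d => [|n IH] X // [L [s1 d]].
exact: (congr1 (fun c => rcons_spl c (ses_unop s1)) (IH L d)).
Qed.

Lemma spl_opK n (Y X : A) (s : splice n Y X) : spl_unop (spl_op s) = s.
Proof.
elim: n Y s => [|n IH] Y; first exact: ses_opK.
by case=> K [s d]; have := spl_unop_rcons (spl_op d) (ses_op s); rewrite IH ses_opK.
Qed.

Lemma spl_unopK n (Y X : A) (s : @splice (op A) n X Y) : spl_op (spl_unop s) = s.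
Proof.
elim: n X s => [|n IH] X; first exact: ses_unopK.
by case=> K [s d]; have := spl_op_rcons (@spl_unop n Y K d) (@ses_unop A K X s);
  rewrite IH ses_unopK.
Qed.

Lemma splmor_op n (Y X Y' X' : A) (s : splice n Y X) (s' : splice n Y' X') b a :
  splmor b a s s' -> @splmor (op A) n _ _ _ _ a b (spl_op s') (spl_op s).
Proof.
elim: n Y Y' b s s' => [|n IH] Y Y' b; first by move=> s s'; apply: smor_op.
move=> [K [s d]] [K' [s' d']] [t [m md]].
by apply: (@splmor_rcons (op A)); [apply: IH md|apply: smor_op].
Qed.

Lemma splmor_unop n (Y X Y' X' : A) (s : @splice (op A) n X Y)
    (s' : @splice (op A) n X' Y') b a :
  splmor b a s s' -> @splmor A n _ _ _ _ a b (spl_unop s') (spl_unop s).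
Proof.
elim: n X X' b s s' => [|n IH] X X' b; first by move=> s s'; apply: smor_unop.
move=> [K [s d]] [K' [s' d']] [t [m md]].
by apply: splmor_rcons; [apply: IH md|apply: smor_unop].
Qed.

Lemma spl_equiv_op n (Y X : A) (s t : splice n Y X) :
  spl_equiv s t -> spl_equiv (spl_op s) (spl_op t).
Proof.
elim=> {s t} [s t m|s|s t _ IH|s t u _ IH1 _ IH2].
- by apply/rst_sym/rst_step; apply: splmor_op.
- exact: rst_refl.
- exact: rst_sym.
- exact: rst_trans IH1 IH2.
Qed.

Lemma spl_equiv_unop n (Y X : A) (s t : @splice (op A) n X Y) :
  spl_equiv s t -> spl_equiv (spl_unop s) (spl_unop t).
Proof.
elim=> {s t} [s t m|s|s t _ IH|s t u _ IH1 _ IH2].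
- by apply/rst_sym/rst_step; apply: splmor_unop.
- exact: rst_refl.
- exact: rst_sym.
- exact: rst_trans IH1 IH2.
Qed.

Lemma Ext_eq0_op n (X Y : A) : Ext_eq0 n.+1 X Y <-> @Ext_eq0 (op A) n.+1 Y X.
Proof.
rewrite !Ext_eq0P; split=> [] [s0 eq0].
  by exists (spl_op s0) => s; rewrite -[s]spl_unopK; apply: spl_equiv_op.
by exists (spl_unop s0) => s; rewrite -[s]spl_opK; apply: spl_equiv_unop.
Qed.

End Opposite_splices.

(** * Exact sequences of Ext and finite resolutions *)

Section Ext_sequences.
Variable A : abelianCat.
Implicit Types K M Y : A.

Lemma Ext_eq0_sub n K M Y (s : ses K M) :
  Ext_eq0 n.+1 (mid s) Y -> Ext_eq0 n.+2 M Y -> Ext_eq0 n.+1 K Y.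
Proof. rewrite !Ext_vanish; exact: ext_vanish_sub. Qed.

Lemma Ext_eq0_quo n K M Y (s : ses K M) :
  Ext_eq0 n.+1 K Y -> Ext_eq0 n.+2 (mid s) Y -> Ext_eq0 n.+2 M Y.
Proof. rewrite !Ext_vanish; exact: ext_vanish_quo. Qed.

End Ext_sequences.

Lemma Ext_eq0_quor (A : abelianCat) n (K M Y : A) (s : ses K M) :
  Ext_eq0 n.+1 Y (mid s) -> Ext_eq0 n.+2 Y K -> Ext_eq0 n.+1 Y M.
Proof.
move=> /Ext_eq0_op vW /Ext_eq0_op vK; apply/Ext_eq0_op.
exact: (Ext_eq0_sub (s := ses_op s) vW vK).
Qed.

Section Resolutions.
Variable A : abelianCat.
Implicit Types (C : set A) (K M N : A).

(** Resolutions built one short exact sequence at a time, for induction along them; coresolutions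
    are the same notion in [op A]. *)
Inductive res C : set A :=
| res_base M of C M : res C M
| res_step K M (s : ses K M) of res C K & C (mid s) : res C M.

Fixpoint spl_mid (n : nat) C Y X : splice n Y X -> Prop :=
  match n with
  | 0 => fun s => C (mid s)
  | n'.+1 => fun w => let: existT K (s, d) := w in C (mid s) /\ spl_mid C d
  end.

Lemma chain_mid_of n C Y X (s : splice n Y X) :
  chain_mid C (chain_of s) <-> spl_mid C s.
Proof.
elim: n Y s => [|n IH] Y /=; first by move=> s; split=> [[]|].
by move=> [K [s d]]; rewrite -IH; case: (chain_of d) => E [].
Qed.

Lemma spl_mid_rcons n C Y K X (d : splice n Y K) (s : ses K X) :
  spl_mid C d -> C (mid s) -> spl_mid C (rcons_spl d s).
Proof. by move=> + cs; elim: n Y d => [|n IH] Y //= [L [s1 d]] [? /IH]. Qed.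

Lemma iso_class C X Y (f : Mor X Y) : iso_closed C -> mono f -> epi f -> C X <-> C Y.
Proof.
move=> isoC mf ef; have [g [gf fg]] := mono_epi_iso mf ef.
by split; apply: isoC; [exists f, g|exists g, f].
Qed.

Lemma idmor_exact X : @exact_chain A 0 X X (idmor X).
Proof. by split; [move=> T u v; rewrite !mcomp1m|apply: epi_idmor]. Qed.

Lemma res_finE C : iso_closed C -> res_fin C = res C.
Proof.
move=> isoC; apply/funext => M; apply/propext; split.
  case=> -[|n] [Y [c [CY mc ec]]].
    by apply: res_base; case: ec => mf ef; apply/(iso_class isoC mf ef).
  have [s sc] := exact_chain_of ec.
  move: mc; rewrite -sc => /chain_mid_of.
  (* The left end is only assumed to lie in [res C], so that the sequences can be absorbed into it
     from left to right. *)
  move: (res_base CY); elim: n Y s {c CY ec sc} => [|n IH] Y.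
    by move=> s rY; apply: (res_step rY).
  by move=> [K [s d]] rY [cs md]; apply: IH md; apply: res_step rY cs.
(* A splice has at least one sequence, so the resolution of length 0 is a separate case. *)
move=> rM; have {rM} [CM|[n [Y [s [CY ms]]]]] : C M \/ exists n Y (s : splice n Y M),
    C Y /\ spl_mid C s.
- elim: rM => {M} [M CM|K M s _ [CK|[n [Y [d [CY md]]]]] cs]; first by left.
    by right; exists 0, K, s.
  by right; exists n.+1, Y, (rcons_spl d s); split=> //; apply: spl_mid_rcons.
- by exists 0, M, (idmor M); split=> //; apply: idmor_exact.
by exists n.+1, Y, (chain_of s); split=> //; [apply/chain_mid_of|apply: chain_of_exact].
Qed.

End Resolutions.

Lemma cores_finE (A : abelianCat) (C : set A) :
  iso_closed C -> cores_fin C = @res (op A) C.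
Proof.
move=> isoC; apply/funext => N; apply/propext; split.
  case=> -[|n] [Y [c [CY mc ec]]].
    by apply: res_base; case: ec => mf ef; apply/(iso_class isoC mf ef).
  have [s sc] := exact_chain_of ec.
  move: mc; rewrite -sc => /chain_mid_of.
  elim: n N s {c ec sc} => [|n IH] N.
    by move=> s; apply: (@res_step (op A) _ _ _ (ses_op s)); apply: res_base.
  move=> [K [s d]] [cs md]; apply: (@res_step (op A) _ _ _ (ses_op s)) => //.
  exact: IH md.
move=> rN; have {rN} [CN|[n [Y [s [CY ms]]]]] : C N \/ exists n Y (s : splice n N Y),
    C Y /\ spl_mid C s.
- elim: rN => {N} [N CN|K N s _ [CK|[n [Y [d [CY md]]]]] cs]; first by left.
    by right; exists 0, K, (ses_unop s).
  by right; exists n.+1, Y, (existT _ K (ses_unop s, d)).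
- by exists 0, N, (idmor N); split=> //; apply: idmor_exact.
by exists n.+1, Y, (chain_of s); split=> //; [apply/chain_mid_of|apply: chain_of_exact].
Qed.

Lemma ext_closed_op (A : abelianCat) (C : set A) :
  ext_closed C -> @ext_closed (op A) C.
Proof. by move=> h X Y Z f g /short_exact_op se CX CZ; apply: h se CZ CX. Qed.

Lemma rel_generator_op (A : abelianCat) (w X : set A) :
  rel_cogenerator w X -> @rel_generator (op A) w X.
Proof.
case=> wX h; split=> // M /h [W [M' [f [g [/short_exact_op se wW XM]]]]].
by exists M', W, g, f.
Qed.

Lemma rel_cogenerator_op (A : abelianCat) (v Y : set A) :
  rel_generator v Y -> @rel_cogenerator (op A) v Y.
Proof.
case=> vY h; split=> // M /h [M' [V [f [g [/short_exact_op se vV YM]]]]].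
by exists V, M', g, f.
Qed.

Lemma Ext_class_eq0_op (A : abelianCat) n (C D : set A) :
  Ext_class_eq0 n.+1 C D <-> @Ext_class_eq0 (op A) n.+1 D C.
Proof.
by split=> h M N CM DN; [apply/(@Ext_eq0_op A _ N M)|apply/Ext_eq0_op]; apply: h.
Qed.

Lemma inf_nat0 (P : nat -> Prop) : inf_nat P = Some 0 <-> P 0.
Proof.
rewrite /inf_nat; case: pselect => [h|h]; last first.
  by split=> // P0; case: h; exists 0; apply/asboolP.
split=> [[e]|P0].
  by case: ex_minnP e => m /asboolP Pm _ m0; rewrite -m0.
by case: ex_minnP => -[|m] // _ /(_ 0); rewrite (introT (asboolP _) P0) => /(_ isT).
Qed.

Lemma inf_natN (P : nat -> Prop) : inf_nat P <> None <-> exists n, P n.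
Proof.
rewrite /inf_nat; case: pselect => [h|h].
  by split=> // _; case: h => n /asboolP; exists n.
by split=> // -[n Pn]; case: h; exists n; apply/asboolP.
Qed.

Lemma pd_class0 (A : abelianCat) (C D : set A) :
  pd_class C D = Some 0 <-> forall i, Ext_class_eq0 i.+1 D C.
Proof.
split=> [/inf_nat0 h i M N DM CN|h].
  have := h _ (ex_intro2 _ _ _ DM erefl).
  case e : (pd C M) => [[|m]|] // _; exact: (proj1 (inf_nat0 _) e).
apply/inf_nat0 => _ [M DM ->].
suff -> : pd C M = Some 0 by [].
by apply/inf_nat0 => -[|i] N // _ CN; apply: h.
Qed.

Lemma idim_class0 (A : abelianCat) (C D : set A) :
  idim_class C D = Some 0 <-> forall i, Ext_class_eq0 i.+1 C D.
Proof.
split=> [/inf_nat0 h i N M CN DM|h].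
  have := h _ (ex_intro2 _ _ _ DM erefl).
  case e : (idim C M) => [[|m]|] // _; exact: (proj1 (inf_nat0 _) e).
apply/inf_nat0 => _ [M DM ->].
suff -> : idim C M = Some 0 by [].
by apply/inf_nat0 => -[|i] N // _ CN; apply: h.
Qed.

(** * Finite balanced systems *)

Section Balanced.
Variable A : abelianCat.
Implicit Types (X Y w v : set A) (K M N : A).

(** By induction [K] embeds in some H in [res w] with cokernel in [X]. The pushout [P] of [mid s]
    and H under [K] is an extension of objects of [X], so it embeds in some [W] in [w] with cokernel
    in [X]. Pushing out along [P -> M] gives [Q], with 0 -> M -> Q -> M2 -> 0 and 0 -> H -> W -> Q
    -> 0. *)
Lemma res_cogenerator X w M : ext_closed X -> rel_cogenerator w X -> res X M ->
  exists M' (s : ses M M'), res w (mid s) /\ X M'.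
Proof.
move=> extX [wX cog]; elim=> {M} [M XM|K M s _ [M1 [s1 [rH XM1]]] XE].
  have [W [M' [f [g [ex wW XM']]]]] := cog M XM.
  by exists M', (Ses ex); split=> //; apply: res_base.
have [P [i [i' [po mi' mi]]]] := pushout_ex (inj s) (inj s1).
have {}mi' := mi' (@inj_mono _ _ _ s); have {}mi := mi (@inj_mono _ _ _ s1).
have [p exP _] := pushout_short_exact po mi' (sesP s).
have [p1 exP1 _] := pushout_short_exact (pushout_sym po) mi (sesP s1).
have [W [M2 [f [g [ex wW XM2]]]]] := cog P (extX _ _ _ _ _ exP1 XE XM1).
have [Q [k [m [po2 mm _]]]] := pushout_ex f p.
have mf : mono f by case: ex.
have [q exQ _] := pushout_short_exact po2 (mm mf) ex.
exists M2, (Ses exQ); split=> //.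
have [pi' pU] := short_exact_cokernel exP.
have exW : short_exact (f \o i') k.
  apply: cokernel_short_exact; first exact: mono_comp.
  split=> [|T t].
    by rewrite mcompA (pushout_comm po2) -mcompA pi' mcompm0.
  rewrite mcompA => /pU [u [up _]].
  have [z zk zm] := pushout_ump po2 (esym up).
  exists z; split=> // z' z'k.
  have ep : epi p by case: exP.
  apply: (pushout_epi po2); first by rewrite zk.
  by apply: ep; rewrite -!mcompA -(pushout_comm po2) !mcompA zk z'k.
exact: (@res_step _ w _ _ (Ses exW)).
Qed.

Lemma res_Ext1 X w v : ext_closed X -> rel_cogenerator w X ->
  Ext_class_eq0 1 (res w) v -> Ext_class_eq0 2 X v -> Ext_class_eq0 1 (res X) v.
Proof.
move=> extX cog wv Xv M V rM vV.
have [M' [s [rH XM']]] := res_cogenerator extX cog rM.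
by apply: (Ext_eq0_sub (s := s)); [apply: wv|apply: Xv].
Qed.

Lemma res_Ext w v :
  Ext_class_eq0 1 (res w) v -> (forall i, Ext_class_eq0 i.+1 w v) ->
  forall i, Ext_class_eq0 i.+1 (res w) v.
Proof.
move=> rv wv; elim=> [//|i IH] M V [{}M wM|K {}M s rK wE] vV; first exact: wv.
by apply: (Ext_eq0_quo (s := s)); [apply: IH|apply: wv].
Qed.

Lemma res_pd w Y M : (forall i, Ext_class_eq0 i.+1 w Y) -> res w M -> pd Y M <> None.
Proof.
move=> wY rM; apply/inf_natN; elim: rM => {M} [M wM|K M s _ [n IH] wE].
  by exists 0 => -[|i] N // _ YN; apply: wY.
(* Each step of the resolution raises the bound by one. *)
exists n.+1 => -[|[|i]] N // ni YN.
by apply: (Ext_eq0_quo (s := s)); [apply: IH|apply: wY].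
Qed.

Lemma generator_Ext Y v M : rel_generator v Y ->
  (forall i V, v V -> Ext_eq0 i.+1 M V) -> pd Y M <> None ->
  forall i N, Y N -> Ext_eq0 i.+1 M N.
Proof.
move=> [vY gen] Mv /inf_natN [n pdM] i.
(* [k] bounds the distance from i to the range where [pdM] applies; each shift along the generator
   trades one unit of [k] for one degree. *)
have [k] : exists k, n <= i + k by exists n; apply: leq_addl.
elim: k i => [|k IH] i nik N YN.
  by apply: pdM => //; rewrite addn0 in nik.
have [N' [V [f [g [ex vV YN']]]]] := gen N YN.
apply: (Ext_eq0_quor (s := Ses ex)); first exact: Mv.
by apply: IH => //; rewrite addSnnS.
Qed.

(** Stated with the hypotheses of one side only, so that it can be reused in [op A] with (X, w) and
    (Y, v) exchanged. *)
Lemma strong_fbs_half X Y w v :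
  ext_closed X -> rel_cogenerator w X -> rel_generator v Y ->
  Ext_class_eq0 1 (res w) v -> Ext_class_eq0 2 X v ->
  (forall i, Ext_class_eq0 i.+1 w v) -> (forall M, res w M -> pd Y M <> None) ->
  Ext_class_eq0 1 (res X) v /\ forall i, Ext_class_eq0 i.+1 (res w) Y.
Proof.
move=> extX cog gen rv Xv wv pdw; split; first exact: res_Ext1 cog rv Xv.
move=> i M N rM YN; apply: (generator_Ext gen _ (pdw M rM)) => // j V vV.
exact: (res_Ext rv wv).
Qed.

End Balanced.

Lemma idim_op (A : abelianCat) (C : set A) (M : A) :
  idim C M <> None <-> @pd (op A) C M <> None.
Proof.
rewrite !inf_natN; split=> -[n h]; exists n => -[|i] N // ni CN.
  by apply/(@Ext_eq0_op A _ N M); apply: h.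
by apply/Ext_eq0_op; apply: h.
Qed.

Theorem proposition3p15 (A : abelianCat) (X Y w v : set A)
    (isoX : iso_closed X) (isoY : iso_closed Y)
    (isow : iso_closed w) (isov : iso_closed v)
    (ptX : pointed_class X) (extX : ext_closed X)
    (ptY : pointed_class Y) (extY : ext_closed Y)
    (cogw : rel_cogenerator w X) (idXw : idim_class X w = Some 0%N)
    (genv : rel_generator v Y) (pdYv : pd_class Y v = Some 0%N) :
  strong_fbs X w v Y <->
  [/\ Ext_class_eq0 1 w^wedge v /\ Ext_class_eq0 2 X v,
      Ext_class_eq0 1 w v^vee /\ Ext_class_eq0 2 w Y,
      forall M : A, w^wedge M -> pd Y M <> None,
      forall N : A, v^vee N -> idim X N <> None
    & idim_class w v = Some 0%N].
Proof.
have wX : (w `<=` X)%classic := proj1 cogw.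
have vY : (v `<=` Y)%classic := proj1 genv.
have rwE := res_finE isow; have rvE := cores_finE isov.
split=> [[[_ _ _ _ [_ rwY] [_ Xrv]] /pd_class0 wY /idim_class0 Xv]|].
  split.
  - by split; [move=> M V rM /vY; apply: rwY|exact: Xv].
  - by split; [move=> W N /wX; apply: Xrv|exact: wY].
  - by rewrite rwE => M; apply: res_pd.
  - rewrite rvE => N rN; apply/idim_op; apply: (@res_pd (op A)) rN => i.
    exact: (proj1 (Ext_class_eq0_op _ _ _)).
  - by apply/idim_class0 => i W V /wX; apply: Xv.
rewrite rwE rvE => -[[rwv Xv] [wrv wY] pdw idv /idim_class0 wv].
have [rXv rwY] := strong_fbs_half extX cogw genv rwv Xv wv pdw.
(* The dual half: in [op A], [v] is a cogenerator in [Y] and [w] a generator in [X]. *)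
have [rYw rvX] : @Ext_class_eq0 (op A) 1 (@res (op A) Y) w /\
    forall i, @Ext_class_eq0 (op A) i.+1 (@res (op A) v) X.
  apply: strong_fbs_half.
  - exact: ext_closed_op.
  - exact: rel_cogenerator_op genv.
  - exact: rel_generator_op.
  - exact: (proj1 (Ext_class_eq0_op _ _ _)).
  - exact: (proj1 (Ext_class_eq0_op _ _ _)).
  - by move=> i; apply: (proj1 (Ext_class_eq0_op _ _ _)).
  - by move=> N rN; apply/idim_op; apply: idv.
split; first split=> //.
- by rewrite res_finE // rwE; split=> //; apply: rwY.
- by rewrite cores_finE // rvE; split; apply/Ext_class_eq0_op.
(* The strong conditions are the vanishing on resolutions of length 0, in all positive degrees. *)
- by apply/pd_class0 => i W N wW; apply: rwY; apply: res_base.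
- apply/idim_class0 => i; apply/Ext_class_eq0_op => V N vV; apply: rvX.
  exact: res_base.
Qed.
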